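(* Let $n,k,r,s,a$ be integers with $k,r\ge2$, $n>a\ge0$, $n\ge rk$, $0\le s<k$ and $a\le r(k-s-1)$. Then $$\chi(\mathrm{KG}^r(n,k,a,s))\ge\left\lceil\frac{n-r(k-\lfloor s/2\rfloor-1)}{r-1}\right\rceil.$$
   Context: For $A,B\subseteq[n]$, write $A\subseteq_sB$ if there is a set $E$ with $|E|\le s$ and $A\setminus E\subseteq B$. $\mathcal{H}(n,k,a,s)$ is the family of all $k$-subsets $F\subseteq[n]$ with $F\not\subseteq_s\{n-a+1,\dots,n\}$. $\mathrm{KG}^r(n,k,a,s)$ is the $r$-uniform hypergraph with vertex set $\mathcal{H}(n,k,a,s)$ and edges all $r$-subsets $\{F_1,\dots,F_r\}$ of vertices with $|F_i\cap F_j|\le s$ for all $1\le i<j\le r$. $\chi$ is the chromatic number (minimum number of colors in a vertex coloring with no monochromatic edge). *)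

(* Defs.v *)
From mathcomp Require Import all_boot.

Set Implicit Arguments.
Unset Strict Implicit.
Unset Printing Implicit Defensive.

Definition subset_upto (T : finType) (s : nat) (A B : {set T}) : bool :=
  [exists E : {set T}, (#|E| <= s) && (A :\: E \subset B)].

(* The ground set {1, ..., n} is 'I_n, with i : 'I_n standing for i + 1;
   thus {n - a + 1, ..., n} is the set of the i with n - a <= i. *)
Definition last_elements (n a : nat) : {set 'I_n} := [set i : 'I_n | n - a <= i].

Definition kfamily (n k a s : nat) : {set {set 'I_n}} :=
  [set F : {set 'I_n} | (#|F| == k) && ~~ subset_upto s F (last_elements n a)].

(* A hypergraph is given by a finite type V of vertices and a set of edges. *)
Definition hypergraph (V : finType) := {set {set V}}.

Definition monochromatic (V : finType) (c : nat) (f : {ffun V -> 'I_c})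
    (e : {set V}) : bool :=
  [exists j : 'I_c, forall v in e, f v == j].

Definition colorable (V : finType) (H : hypergraph V) (c : nat) : bool :=
  [exists f : {ffun V -> 'I_c}, forall e in H, ~~ monochromatic f e].

(* Bounding the search by #|V| loses nothing when every edge has at least two
   vertices (chromatic_numberP). If some edge has fewer, V being nonempty,
   there is no proper coloring and the value is the default #|V|. *)
Definition chromatic_number (V : finType) (H : hypergraph V) : nat :=
  [arg min_(c < (ord_max : 'I_#|V|.+1) | colorable H c) (c : nat)].

Definition vertex (n k a s : nat) : finType :=
  {F : {set 'I_n} | F \in kfamily n k a s}.

Definition KG (r n k a s : nat) : hypergraph (vertex n k a s) :=
  [set e : {set vertex n k a s} | (#|e| == r) &&
     [forall F in e, forall G in e, (F != G) ==> (#|val F :&: val G| <= s)]].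

Lemma colorable_card (V : finType) (H : hypergraph V) :
  {in H, forall e : {set V}, 1 < #|e|} -> colorable H #|V|.
Proof.
move=> H2; apply/existsP; exists [ffun v => enum_rank v].
apply/forall_inP => e /H2/card_gt1P [x [y [xe ye xy]]].
apply/existsPn => j; apply/negP => /forall_inP m.
move: (m _ xe) (m _ ye) xy; rewrite !ffunE => /eqP <- /eqP/enum_rank_inj ->.
by rewrite eqxx.
Qed.

Lemma chromatic_numberP (V : finType) (H : hypergraph V) :
  {in H, forall e : {set V}, 1 < #|e|} ->
  colorable H (chromatic_number H) /\
  (forall c, colorable H c -> chromatic_number H <= c).
Proof.
move=> H2; rewrite /chromatic_number; case: arg_minnP => [|i Hi min].
  exact: colorable_card.
split=> // c Hc; case: (ltnP c #|V|.+1) => [lt_c|/ltnW le_c].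
  exact: (min (Ordinal lt_c)).
by apply: leq_trans le_c; rewrite -ltnS.
Qed.

Lemma KG_uniform (r n k a s : nat) : {in KG r n k a s, forall e : {set vertex n k a s}, #|e| = r}.
Proof. by move=> e; rewrite inE => /andP[/eqP]. Qed.

(* Main.v *)
(* Padding a set of size k - t, t = floor (s / 2), by t further elements turns
   pairwise disjoint sets into sets meeting in at most 2 t <= s elements. Together
   with |F \ L| > s <=> |F :&: L| <= k - s - 1, where L is the set of the last a
   elements, this reduces the theorem to a Kneser-type statement: if N has more
   than r (k - 1) + (r - 1) c elements, of which at most r q lie in L, then every
   c-coloring of the k-subsets of N with at most q elements in L has r pairwise
   disjoint sets of the same color.

   The statement for r1 and r2 implies it for r1 r2: color a set M of
   r2 (k - 1) + (r2 - 1) c + 1 elements, at most r2 q of them in L, with the color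
   of r2 disjoint sets of one color inside M. So r = p may be assumed prime, where
   a Z_p-Tucker lemma applies to the partial labellings X of N by Z_p. If a
   fiber of X contains a colored set, X is sent to level p (k - 1) + the number of
   pairs (i, color of a set in the i-th fiber); otherwise to level
   sum_i min (|X_i|, k - 1), and it is the bound on |N :&: L| that makes an
   equivariant choice of sign possible on the top level p (k - 1).

   The Tucker lemma is Dold's theorem for the join of copies of Z_p: bar cochains
   on Z_p, pulled back along the signs, evaluate to 1 on an equivariant resolution
   of the join, while they vanish on chains along which a sign is repeated. *)
Require Import Defs.
From mathcomp Require Import all_boot all_order all_algebra.
From mathcomp Require Import zify ring.
Set Implicit Arguments.
Unset Strict Implicit.
Unset Printing Implicit Defensive.
Import Order.TTheory GRing.Theory Num.Theory.
Local Open Scope ring_scope.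

(** * Cochains on sequences *)

Section Cochains.
Variables (R : comNzRingType) (T : Type).
Implicit Types (w : seq T -> R) (s : seq T).

(* The empty sequence has degree -1, so the complex is augmented. *)
Fixpoint cobd w s : R :=
  if s is x :: s' then w s' - cobd (fun t => w (x :: t)) s' else 0.

Lemma eq_cobd w1 w2 s : w1 =1 w2 -> cobd w1 s = cobd w2 s.
Proof.
elim: s w1 w2 => //= x s IH w1 w2 e; congr (_ - _); first exact: e.
by apply: IH => t; apply: e.
Qed.

Lemma cobd0 s : cobd (fun=> 0) s = 0.
Proof. by elim: s => //= x s ->; rewrite subr0. Qed.

Lemma cobdB w1 w2 s : cobd (fun t => w1 t - w2 t) s = cobd w1 s - cobd w2 s.
Proof. by elim: s w1 w2 => [|x s IH] w1 w2 /=; rewrite ?IH; ring. Qed.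

Lemma cobd_sum (I : finType) (F : I -> seq T -> R) s :
  cobd (fun t => \sum_i F i t) s = \sum_i cobd (F i) s.
Proof.
elim: s F => [|x s IH] F /=; first by rewrite big1.
by rewrite IH sumrB.
Qed.

Lemma cobd_cobd w s : cobd (cobd w) s = 0.
Proof. by elim: s w => //= x s IH w; rewrite cobdB IH; ring. Qed.

End Cochains.

Lemma cobd_map (R : comNzRingType) (S T : Type) (h : S -> T) (w : seq T -> R) s :
  cobd w (map h s) = cobd (fun t => w (map h t)) s.
Proof. by elim: s w => //= x s IH w; rewrite IH. Qed.

(** * Prisms, cones and normalized cochains *)

Section Cone.
Variables (R : comNzRingType) (T : Type).
Implicit Types (w : seq T -> R) (s : seq T) (h : T -> T) (e : T).

(* The dual of the chain homotopy from the identity to [h]. *)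
Fixpoint prism h w s : R :=
  if s is x :: s' then
    w (x :: h x :: map h s') - prism h (fun t => w (x :: t)) s'
  else 0.

Lemma eq_prism h w1 w2 s : w1 =1 w2 -> prism h w1 s = prism h w2 s.
Proof.
elim: s w1 w2 => //= x s IH w1 w2 e; congr (_ - _); first exact: e.
by apply: IH => t; apply: e.
Qed.

Lemma prismB h w1 w2 s :
  prism h (fun t => w1 t - w2 t) s = prism h w1 s - prism h w2 s.
Proof. by elim: s w1 w2 => [|x s IH] w1 w2 /=; rewrite ?IH; ring. Qed.

Lemma cobd_prism h w s :
  cobd (prism h w) s + prism h (cobd w) s = w (map h s) - w s.
Proof.
elim: s w => [|x s IH] w /=; first by ring.
rewrite cobdB prismB cobd_map.
have /= := IH (fun t => w (x :: t)).
move/(canRL (addrK _)) => ->; ring.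
Qed.

(** Dual to sending a chain to the cone with apex [e] over its image under [h], minus the prism from
    the chain to this image; a contracting homotopy by [cobd_cone]. *)
Definition cone e h w s := w (e :: map h s) - prism h w s.

Lemma cobd_cone e h w s : cobd (cone e h w) s = w s - cone e h (cobd w) s.
Proof.
rewrite /cone cobdB /= cobd_map.
by have /(canRL (addrK _)) -> := cobd_prism h w s; ring.
Qed.

Definition normalized w := forall s1 x s2, w (s1 ++ x :: x :: s2) = 0.

(** The two faces that drop one of the equal neighbours cancel; every other face keeps the
    repetition. *)
Lemma normalized_cobd w : normalized w -> normalized (cobd w).
Proof.
move=> nw s1 x s2; elim: s1 w nw => [|y s1 IH] w nw /=.
  rewrite (@eq_cobd _ _ _ (fun=> 0)) ?cobd0; first by ring.
  by move=> t; apply: (nw [::]).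
by rewrite nw IH ?subrr // => s1' x' s2'; apply: (nw (y :: s1')).
Qed.
End Cone.

Lemma Zp_card0 m : (m.+2)%:R = 0 :> 'I_m.+2.
Proof. by rewrite Zp_nat; apply/val_inj; rewrite /= modnn. Qed.

(** * Bar cochains of a cyclic group *)

Section Resolution.
Variable m : nat.
Local Notation Z := 'I_m.+2.
Variables (R : comNzRingType).
Hypothesis R0 : (m.+2)%:R = 0 :> R.

Section Act.
Variables (T : Type) (act : Z -> T -> T).
Implicit Types (w : seq T -> R) (s : seq T).

(* The alternating differentials [g - 1] and [1 + g + ... + g ^ (m + 1)] of the
   periodic resolution of a cyclic group, preceded by the identity. *)
Definition resop k w s :=
  if k is k'.+1 then
    if odd k then w (map (act 1) s) - w s else \sum_a w (map (act a) s)
  else w s.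

Lemma eq_resop k w1 w2 s : w1 =1 w2 -> resop k w1 s = resop k w2 s.
Proof.
move=> e; case: k => [|k] /=; first exact: e.
by case: ifP => _; [rewrite !e | apply: eq_bigr => a _; apply: e].
Qed.

Lemma resopB k w1 w2 s :
  resop k (fun t => w1 t - w2 t) s = resop k w1 s - resop k w2 s.
Proof.
case: k => [|k] //=; case: ifP => _; first by ring.
by rewrite sumrB.
Qed.

Lemma resop_cobd k w s : resop k (cobd w) s = cobd (resop k w) s.
Proof.
case: k => [|k] /=; first exact: eq_cobd.
rewrite /resop /=; case: ifP => ok; first by rewrite cobdB cobd_map.
by rewrite cobd_sum; apply: eq_bigr => a _; rewrite cobd_map.
Qed.

Hypothesis actD : forall a b t, act a (act b t) = act (a + b) t.

(** The norm, a sum over the whole group, is unchanged by a shift, so its products with g - 1 vanish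
    in either order. *)
Lemma resop_resop k w s : (0 < k)%N -> resop k (resop k.+1 w) s = 0.
Proof.
case: k => // k _; rewrite /resop /= negbK.
have shift : \sum_a w (map (act a) (map (act 1) s)) = \sum_a w (map (act a) s).
  rewrite [RHS](reindex_inj (addIr 1)) /=; apply: eq_bigr => a _.
  by rewrite -map_comp; congr w; apply: eq_map => t /=; rewrite actD.
case: (odd k) => /=; last by rewrite shift subrr.
rewrite sumrB -[in RHS](subrr (\sum_a w (map (act a) s))); congr (_ - _).
rewrite -shift; apply: eq_bigr => a _; rewrite -!map_comp; congr w.
by apply: eq_map => t /=; rewrite !actD addrC.
Qed.
End Act.

Local Notation op := (resop (fun a x : Z => a + x)).

Definition transl (a : Z) (s : seq Z) := map (+%R a) s.
Arguments transl : simpl never.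

Lemma transl_transl a b s : transl a (transl b s) = transl (a + b) s.
Proof. by rewrite /transl -map_comp; apply: eq_map => x /=; rewrite addrA. Qed.

Lemma transl0 s : transl 0 s = s.
Proof. by rewrite /transl -[RHS]map_id; apply: eq_map => x /=; rewrite add0r. Qed.

(** For odd [k], [w] is summed over the translates of [s] whose first entry is below that of [s], so
    that g - 1 telescopes. For even [k > 0], [w] is restricted to the sequences starting with 0, a
    fundamental domain, so that the norm restores an invariant [w]. *)
Definition primitive k (w : seq Z -> R) (s : seq Z) : R :=
  if k is 0%N then w s else
  if s is x :: _ then
    if odd k then \sum_(a : Z | (a < x)%N) w (transl (a - x) s)
    else if x == 0 then w s else 0
  else 0.

(** Exactness of the periodic complex: the group acts freely on nonempty sequences, and the first
    entry locates a sequence in its orbit. *)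
Lemma resop_primitive k w s : (0 < k)%N -> w [::] = 0 ->
  (forall t, op k.+1 w t = 0) -> op k (primitive k w) s = w s.
Proof.
case: k => // k _ w0; case: s => [|x s].
  by rewrite /resop /= w0; case: (odd k) => /= _; rewrite ?subrr ?big1.
rewrite /resop /=; case: (odd k) => /= Hw; last first.
  have tr (a : Z) : transl (a - (1 + x)) (1 + x :: [seq 1 + i | i <- s]) =
      transl (a - x) (x :: s).
    rewrite -[_ :: _]/(transl 1 (x :: s)) transl_transl; congr transl; ring.
  under eq_bigr do rewrite tr.
  case: (ltnP x.+1 m.+2) => [lt_x | ge_x].
    have vx : ((1 %% m.+2 + x) %% m.+2)%N = x.+1.
      by rewrite (modn_small (isT : 1 < m.+2)%N) modn_small.
    rewrite vx (bigD1 x) //= subrr transl0 -addrA -[RHS]addr0; congr (_ + _).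
    apply/eqP; rewrite subr_eq0; apply/eqP/eq_bigl => a.
    by rewrite ltnS ltn_neqAle andbC.
  (* Here [1 + x] wraps around to 0 and the first sum is empty; the vanishing sum over the whole
     orbit gives the value of the second. *)
  have ex : x.+1 = m.+2 by apply/eqP; rewrite eqn_leq ltn_ord ge_x.
  have vx : ((1 %% m.+2 + x) %% m.+2)%N = 0%N.
    by rewrite (modn_small (isT : 1 < m.+2)%N) add1n ex modnn.
  have : \sum_(a : Z) w (transl (a - x) (x :: s)) = 0.
    rewrite -[RHS](Hw (transl (- x) (x :: s))).
    by apply: eq_bigr => a _; rewrite -transl_transl.
  rewrite (bigD1 x) // subrr transl0 => /(canRL (addrK _)); rewrite sub0r => e.
  rewrite big_pred0 => [|a]; last by rewrite /= vx.
  rewrite sub0r e; congr (- _).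
  by apply: eq_bigl => a; rewrite -val_eqE /= ltn_neqAle -ltnS ex ltn_ord andbT.
(* Only the translate starting with 0 survives in the norm; by [Hw], [w] is invariant and takes the
   same value on [x :: s]. *)
rewrite (bigD1 (- x)) // big1 ?addr0 /= => [|a]; last first.
  by rewrite -addr_eq0; case: eqP.
case: eqP => [_|]; last by rewrite addNr.
have inv (t : seq Z) : w (transl 1 t) = w t.
  by have /eqP := Hw t; rewrite /resop /= subr_eq0 => /eqP.
have invn n t : w (transl n%:R t) = w t.
  elim: n t => [|n IH] t; first by rewrite transl0.
  by rewrite -natr1 addrC -transl_transl inv IH.
rewrite -[_ :: _]/(transl (- x) (x :: s)).
by rewrite addr0 -[- x]valZpK -Zp_nat invn.
Qed.

Lemma normalized_primitive k w : normalized w -> normalized (primitive k w).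
Proof.
move=> nw s1 x s2; have nt a : w (transl a (s1 ++ x :: x :: s2)) = 0.
  by rewrite /transl map_cat /= nw.
case: k => [|k] /=; first exact: nw.
case E: (s1 ++ _) => [|y s] //; rewrite -E.
by case: ifP => _; [apply: big1 | rewrite nw if_same].
Qed.

(** A zigzag: a primitive for the resolution operator, then the coboundary. The k-th term lives on
    sequences of length k. *)
Fixpoint bar_cochain k : seq Z -> R :=
  if k is k'.+1 then cobd (primitive k' (bar_cochain k'))
  else fun s => (nilp s)%:R.

Lemma bar_cochain1 s : bar_cochain 1 s = (size s == 1%N)%:R.
Proof. by case: s => [|x [|y s]] /=; rewrite ?cobd0 ?subr0. Qed.

(** For k >= 1, the operator of index k + 1 must kill [bar_cochain k]. For k = 1 the norm of a
    constant is a multiple of [m.+2], zero in [R]; beyond, the periodicity of the operators and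
    [cobd_cobd] carry this on. *)
Lemma primitive_bar_cochain k s :
  op k (primitive k (bar_cochain k)) s = bar_cochain k s.
Proof.
case: k s => // k s; apply: resop_primitive => //.
elim: k {s} => [|k IH] s.
  rewrite /resop -[odd 2]/false (eq_bigr (fun=> bar_cochain 1 s)).
    by rewrite sumr_const card_ord -mulr_natl R0 mul0r.
  by move=> a _; rewrite !bar_cochain1 size_map.
rewrite -[bar_cochain k.+2]/(cobd (primitive k.+1 (bar_cochain k.+1))) resop_cobd.
rewrite (@eq_cobd _ _ _ (bar_cochain k.+1)) ?cobd_cobd // => t.
have -> : op k.+3 (primitive k.+1 (bar_cochain k.+1)) t
  = op k.+1 (primitive k.+1 (bar_cochain k.+1)) t by rewrite /resop /= negbK.
exact: resop_primitive.
Qed.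

Lemma normalized_bar_cochain k : normalized (bar_cochain k).
Proof.
elim: k => [|k IH]; first by case.
exact/normalized_cobd/normalized_primitive.
Qed.
End Resolution.
Arguments primitive : simpl never.
Arguments bar_cochain : simpl never.

(** * A Tucker lemma for Z_p-labellings *)

Lemma eq_prism_in (R : comNzRingType) (T : Type) (h : T -> T) (w1 w2 : seq T -> R) s :
  (forall s1 y s2, s = s1 ++ y :: s2 ->
     w1 (s1 ++ y :: h y :: map h s2) = w2 (s1 ++ y :: h y :: map h s2)) ->
  prism h w1 s = prism h w2 s.
Proof.
elim: s w1 w2 => //= x s IH w1 w2 e; congr (_ - _).
  exact: (e [::]).
by apply: IH => s1 y s2 def; apply: (e (x :: s1)); rewrite def.
Qed.

Section Tucker.
Variables (m : nat) (T : finType).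
Local Notation Z := 'I_m.+2.
Local Notation vec := {ffun T -> option Z}.
Implicit Types (X Y : vec) (r : seq T) (s : seq vec) (w : seq vec -> Z).

Definition rot_vec (a : Z) X : vec := [ffun x => omap (+%R a) (X x)].
Definition le_vec X Y := [forall x, (X x == None) || (X x == Y x)].
Definition put x X : vec := [ffun y => if y == x then Some 0 else X y].
Definition single x : vec := [ffun y => if y == x then Some 0 else None].
Definition supp X := [set x | X x != None].
Definition dom r X := (supp X != set0) && (supp X \subset r).

Lemma le_vecP X Y :
  reflect (forall x, X x != None -> X x = Y x) (le_vec X Y).
Proof.
apply: (iffP forallP) => [h x nz | h x].
  by have := h x; rewrite (negPf nz) => /eqP.
by case: eqP => //= /eqP /h ->.
Qed.

Lemma le_vec_trans X Y Z : le_vec X Y -> le_vec Y Z -> le_vec X Z.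
Proof.
move=> /le_vecP xy /le_vecP yz; apply/le_vecP => x nz.
by rewrite xy // yz // -xy.
Qed.

Lemma supp_rot a X : supp (rot_vec a X) = supp X.
Proof. by apply/setP => x; rewrite !inE ffunE; case: (X x). Qed.

Lemma rot_vecD a b X : rot_vec a (rot_vec b X) = rot_vec (a + b) X.
Proof. by apply/ffunP => x; rewrite !ffunE; case: (X x) => //= i; rewrite addrA. Qed.

Lemma le_vec_rot a X Y : le_vec X Y -> le_vec (rot_vec a X) (rot_vec a Y).
Proof.
move=> /le_vecP h; apply/le_vecP => x; rewrite !ffunE.
by case E: (X x) => [i|] // _; rewrite -h E.
Qed.

Lemma le_vec_put x X Y : le_vec X Y -> le_vec (put x X) (put x Y).
Proof.
move=> /le_vecP h; apply/le_vecP => y; rewrite !ffunE.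
by case: (y =P x) => // _; apply: h.
Qed.

Lemma le_put x X : x \notin supp X -> le_vec X (put x X).
Proof.
rewrite inE negbK => /eqP h; apply/le_vecP => y; rewrite ffunE.
by case: (y =P x) => // ->; rewrite h.
Qed.

Lemma le_single x X : le_vec (single x) (put x X).
Proof. by apply/le_vecP => y; rewrite !ffunE; case: (y =P x). Qed.

Lemma supp_put x X : supp (put x X) = x |: supp X.
Proof. by apply/setP => y; rewrite !inE ffunE; case: (y =P x). Qed.

Lemma supp_single x : supp (single x) = [set x].
Proof. by apply/setP => y; rewrite !inE ffunE; case: (y =P x). Qed.

(** The sequences that matter to [fund], by [eq_fund_in]; repetitions are allowed. *)
Definition chain r s := [&& size s == size r, pairwise le_vec s & all (dom r) s].

Lemma chain_rot a r s : chain r s -> chain r (map (rot_vec a) s).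
Proof.
case/and3P => sz pw al; apply/and3P; split.
- by rewrite size_map.
- by rewrite pairwise_map; apply: sub_pairwise pw => X Y; apply: le_vec_rot.
by rewrite all_map; apply: sub_all al => X; rewrite /= /dom supp_rot.
Qed.

Lemma dom_put x r X : supp X \subset r -> dom (x :: r) (put x X).
Proof.
move=> sX; rewrite /dom supp_put; apply/andP; split.
  by apply/set0Pn; exists x; rewrite setU11.
by apply/subsetP => y; rewrite !inE => /orP[->//|yX]; rewrite (subsetP sX) ?orbT // inE.
Qed.

Lemma dom_sub r1 r2 X : {subset r1 <= r2} -> dom r1 X -> dom r2 X.
Proof.
move=> sub /andP[X0 /subsetP sX]; apply/andP; split=> //.
by apply/subsetP => y /sX; apply: sub.
Qed.

Lemma dom_cons x r X : dom r X -> dom (x :: r) X.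
Proof. by apply: dom_sub => y yr; rewrite inE yr orbT. Qed.

Lemma chain_cone x r s : chain r s -> chain (x :: r) (single x :: map (put x) s).
Proof.
case/and3P => sz pw al; apply/and3P; split => /=.
- by rewrite size_map eqSS.
- rewrite all_map pairwise_map; apply/andP; split.
    by apply/allP => X _; apply: le_single.
  by apply: sub_pairwise pw => X Y; apply: le_vec_put.
rewrite all_map; apply/andP; split.
  rewrite /dom supp_single; apply/andP; split.
    by apply/set0Pn; exists x; rewrite set11.
  by apply/subsetP => y; rewrite !inE => ->.
by apply: sub_all al => X /andP[_ sX]; apply: dom_put.
Qed.

(** As [x] lies outside [r], [put x] only extends the labellings, so passing from [y] to [put x y]
    keeps the chain increasing. *)
Lemma chain_prism x r s1 y s2 : x \notin r -> chain r (s1 ++ y :: s2) ->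
  chain (x :: r) (s1 ++ y :: put x y :: map (put x) s2).
Proof.
move=> xr /and3P[sz pw al]; apply/and3P.
have lep X : X \in s1 ++ y :: s2 -> le_vec X (put x X).
  move=> /(allP al)/andP[_ sX]; apply: le_put; apply: contra xr.
  exact: (subsetP sX).
split.
- by move: sz; rewrite /= !size_cat /= size_map !addnS eqSS.
- move: pw; rewrite !pairwise_cat /= !all_map !pairwise_map.
  case/and3P => /allrelP le1 pw1 /andP[/allP le2 pw2].
  have yin : y \in s1 ++ y :: s2 by rewrite mem_cat mem_head orbT.
  have s2in u : u \in s2 -> u \in s1 ++ y :: s2.
    by move=> us; rewrite mem_cat inE us !orbT.
  rewrite pw1 lep //=; apply/and4P; split.
  + apply/allrelP => X Y Xs; rewrite !inE => /or3P[/eqP->|/eqP->|/mapP[Y' Ys ->]].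
    * by apply: le1 => //; apply: mem_head.
    * by apply: le_vec_trans (lep _ yin); apply: le1 => //; apply: mem_head.
    by apply: le_vec_trans (lep _ (s2in _ Ys)); apply: le1 => //; rewrite inE Ys orbT.
  + apply/allP => Y Ys /=; apply: le_vec_trans (lep _ (s2in _ Ys)); exact: le2.
  + by apply/allP => Y Ys /=; apply/le_vec_put/le2.
  by apply: sub_pairwise pw2 => X Y; apply: le_vec_put.
move: al; rewrite !all_cat /= all_map => /and3P[al1 aly al2].
apply/and4P; split.
- by apply: sub_all al1 => X; apply: dom_cons.
- exact: dom_cons.
- by apply: dom_put; case/andP: aly.
by apply: sub_all al2 => X /andP[_ sX]; apply: dom_put.
Qed.

(* Evaluation on the chain x_r with x_[::] the empty sequence and x_(x :: r) the
   cone over the image of x_r under the differential of the resolution; see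
   [fund_cobd]. *)
Fixpoint fund r w : Z :=
  if r is x :: r' then
    fund r' (resop rot_vec (size r') (cone (single x) (put x) w))
  else w [::].

Lemma eq_fund_in r w1 w2 : uniq r ->
  (forall s, chain r s -> w1 s = w2 s) -> fund r w1 = fund r w2.
Proof.
elim: r w1 w2 => [|x r IH] w1 w2 /=; first by move=> _; apply.
case/andP => xr ur e; apply: IH => // s cs.
have ec t : chain r t -> cone (single x) (put x) w1 t = cone (single x) (put x) w2 t.
  move=> ct; rewrite /cone e ?chain_cone //; congr (_ - _).
  apply: eq_prism_in => s1 y s2 def; apply: e; apply: chain_prism => //.
  by rewrite -def.
rewrite /resop; case: (size r) => [|k]; first exact: ec.
case: ifP => _; first by rewrite !ec ?chain_rot.
by apply: eq_bigr => a _; rewrite ec ?chain_rot.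
Qed.

Lemma eq_fund r w1 w2 : w1 =1 w2 -> fund r w1 = fund r w2.
Proof.
elim: r w1 w2 => [|x r IH] w1 w2 e /=; first exact: e.
apply: IH => s; apply: eq_resop => t; rewrite /cone e; congr (_ - _).
exact: eq_prism.
Qed.

Lemma fundB r w1 w2 : fund r (fun t => w1 t - w2 t) = fund r w1 - fund r w2.
Proof.
elim: r w1 w2 => //= x r IH w1 w2; rewrite -IH; apply: eq_fund => s.
rewrite -resopB; apply: eq_resop => t; rewrite /cone prismB; ring.
Qed.

Lemma fund0 r : fund r (fun=> 0) = 0.
Proof.
rewrite -[RHS](subrr (fund r (fun=> 0))) -fundB.
by apply: eq_fund => s; rewrite subr0.
Qed.

(** By [cobd_cone] the evaluation splits into the claimed term and one on a coboundary, where the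
    induction hypothesis produces two consecutive operators of the resolution, with composite 0. *)
Lemma fund_cobd x r w : fund (x :: r) (cobd w) = fund r (resop rot_vec (size r) w).
Proof.
elim: r x w => [|y r IH] x w.
  by rewrite /= /cone /=; ring.
set c := cone (single x) (put x) w; set k := size (y :: r).
have -> : fund (x :: y :: r) (cobd w) =
    fund (y :: r) (fun t => resop rot_vec k w t - cobd (resop rot_vec k c) t).
  apply: (@eq_fund (y :: r)) => t; rewrite -resop_cobd -resopB; apply: eq_resop => u.
  by rewrite cobd_cone opprB addrC subrK.
rewrite fundB IH [X in _ - X](_ : _ = 0) ?subr0 //.
(* With [r] empty the operator of index 0 is the identity, but g - 1 vanishes on the empty
   sequence. *)
case: r @k {IH} => [|z r] k; first by rewrite /= /resop /= subrr.
rewrite -[RHS](fund0 (z :: r)); apply: eq_fund => s.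
by apply: resop_resop => //; apply: rot_vecD.
Qed.

(** * Signs and levels on the nonempty labellings *)

Section Labelling.
Variables (r : seq T) (M : nat) (sg : vec -> Z) (lev : vec -> nat).
Hypothesis uniq_r : uniq r.
Hypothesis sg_rot : forall a X, dom r X -> sg (rot_vec a X) = a + sg X.
Hypothesis lev_bound : forall X, dom r X -> (0 < lev X <= M)%N.
Hypothesis lev_mono : forall X Y, dom r X -> dom r Y -> le_vec X Y ->
  (lev X <= lev Y)%N /\ (lev X = lev Y -> sg X = sg Y).

(** A [bar_cochain] of positive index is the coboundary of a primitive; [fund_cobd] trades this
    coboundary for a resolution operator, which undoes the primitive because [sg] is equivariant. *)
Lemma fund_bar r' : uniq r' -> {subset r' <= r} ->
  fund r' (fun s => bar_cochain Z (size r') (map sg s)) = 1.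
Proof.
elim: r' => // x r' IH /= /andP[xr ur] sub.
have sub' : {subset r' <= r} by move=> y yr; apply: sub; rewrite inE yr orbT.
rewrite -[LHS]/(fund (x :: r') _).
pose k := size r'; pose z := fun s => primitive k (bar_cochain Z k) (map sg s).
rewrite (@eq_fund _ _ (cobd z)) => [|s]; last first.
  exact: (cobd_map sg (primitive k (bar_cochain Z k)) s).
rewrite fund_cobd -(IH ur sub'); apply: eq_fund_in => // s /and3P[_ _ ds].
have R0 := Zp_card0 m.
rewrite -(primitive_bar_cochain R0) /z /resop -/k.
have rotE a : map sg (map (rot_vec a) s) = map (fun x => a + x) (map sg s).
  rewrite -!map_comp; apply/eq_in_map => X /(allP ds) dX /=.
  by apply: sg_rot; apply: dom_sub dX.
case: (k) => //= k'; case: ifP => _; first by rewrite rotE.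
by apply: eq_bigr => a _; rewrite rotE.
Qed.

(** Otherwise a chain has more members than there are levels, so its levels fail to increase
    strictly; then two neighbours share level and sign, and the normalized cochain vanishes,
    contradicting [fund_bar]. *)
Theorem Zp_tucker : (size r <= M)%N.
Proof.
rewrite leqNgt; apply/negP => ltM.
have := fund_bar uniq_r (fun x => id).
rewrite (eq_fund_in uniq_r (w2 := fun=> 0)) ?fund0 => [/esym/eqP|s].
  by rewrite oner_eq0.
case/and3P => /eqP sz pw ds.
have [lts | nlts] := boolP (sorted ltn (map lev s)).
  have /uniq_leq_size : uniq (map lev s) by rewrite (sorted_uniq ltn_trans ltnn).
  move=> /(_ (iota 1 M)); rewrite size_map size_iota sz leqNgt ltM.
  case/(_ _)/negP => //.
  move=> l /mapP[X Xs ->]; rewrite mem_iota add1n ltnS; apply: lev_bound.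
  exact: (allP ds).
have [s1 [X [Y [s2 [def le_XY]]]]] : exists s1 X Y s2,
    s = s1 ++ X :: Y :: s2 /\ (lev Y <= lev X)%N.
  elim: s nlts {sz pw ds} => // X [|Y s] //= IH; rewrite negb_and -leqNgt.
  case/orP => [le_YX | /IH [s1 [X' [Y' [s2 [-> le_YX]]]]]].
    by exists [::], X, Y, s.
  by exists (X :: s1), X', Y', s2.
have sgE : sg X = sg Y.
  move: pw ds; rewrite def pairwise_cat all_cat /=.
  case/and3P => _ _ /and3P[/andP[leXY _] _ _] /and4P[_ dX dY _].
  have [le1 le2] := lev_mono dX dY leXY.
  by apply: le2; apply/eqP; rewrite eqn_leq le1.
by rewrite def map_cat /= sgE; apply: normalized_bar_cochain.
Qed.
End Labelling.
End Tucker.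

(** * The prime case *)

Section Mean.
Variables (p : nat) (p_pr : prime p).
Implicit Types (a i : 'F_p) (S : {set 'F_p}).

Definition proper_part S := (S != set0) && (S != setT).
(* An equivariant choice of an element of 'F_p for a proper part. *)
Definition mean S : 'F_p := (\sum_(i in S) i) / #|S|%:R.
Definition shift a S := [set i | i - a \in S].

Lemma card_shift a S : #|shift a S| = #|S|.
Proof.
rewrite -[RHS](card_imset _ (addrI a)); apply: eq_card => i; rewrite inE.
apply/idP/imsetP => [iS | [j jS ->]]; last by rewrite addrAC subrr add0r.
by exists (i - a); rewrite // addrC subrK.
Qed.

Lemma shift_eq0 a S : (shift a S == set0) = (S == set0).
Proof. by rewrite -!cards_eq0 card_shift. Qed.

Lemma proper_part_shift a S : proper_part (shift a S) = proper_part S.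
Proof. by rewrite /proper_part shift_eq0 !eqEcard !subsetT card_shift. Qed.

(** The shift adds [a] times [#|S|] to the sum, and 0 < [#|S|] < p makes [#|S|] invertible modulo
    the prime p. *)
Lemma mean_shift a S : proper_part S -> mean (shift a S) = a + mean S.
Proof.
case/andP => S0 ST; rewrite /mean card_shift.
have cardS : (#|S|%:R : 'F_p) != 0.
  rewrite -(dvdn_pcharf (pchar_Fp p_pr)) gtnNdvd ?card_gt0 //.
  by rewrite -[X in (_ < X)%N](card_Fp p_pr) -cardsT proper_card // properT.
have -> : \sum_(i in shift a S) i = \sum_(i in S) (i + a).
  rewrite [LHS](reindex_inj (addIr a)) /=; apply: eq_bigl => i.
  by rewrite inE addrK.
by rewrite big_split /= sumr_const -[a *+ _]mulr_natr mulrDl mulfK // addrC.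
Qed.
End Mean.

Section Sets.
Variable T : finType.
Implicit Types (A B F G L N : {set T}).

Lemma exists_card_between A B k : B \subset A -> (#|B| <= k <= #|A|)%N ->
  exists F, [/\ B \subset F, F \subset A & #|F| = k].
Proof.
move=> sBA; elim: k => [|k IH] /andP[leB leA].
  by exists B; split=> //; apply/eqP; rewrite -leqn0.
have [eB | neB] := eqVneq #|B| k.+1; first by exists B.
have [|F [sBF sFA cF]] := IH; first by rewrite -ltnS ltn_neqAle neB leB ltnW.
have /properP[_ [x xA xF]] : F \proper A by rewrite properEcard sFA cF.
exists (x |: F); split; first by rewrite (subset_trans sBF) ?subsetU1.
  by rewrite subUset sub1set xA.
by rewrite cardsU1 xF cF.
Qed.

Definition sparse N L (k q : nat) G :=
  [&& G \subset N, #|G| == k & (#|G :&: L| <= q)%N].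

(** Elements of [A] outside [L] are used first; if they are fewer than [k], the remaining ones, at
    most [q], come from [L]. *)
Lemma exists_sparse N L k q A : A \subset N -> (k <= #|A|)%N ->
  (k <= #|A :\: L| + q)%N -> exists2 G, sparse N L k q G & G \subset A.
Proof.
move=> sAN kA kq; have cA := cardsID L A.
have [kAL | ltk] := leqP k #|A :\: L|.
  have [|G [_ sG cG]] := @exists_card_between (A :\: L) set0 k (sub0set _).
    by rewrite cards0.
  have sGA : G \subset A by apply: subset_trans sG (subsetDl _ _).
  exists G => //; rewrite /sparse cG eqxx (subset_trans sGA) //=.
  suff -> : G :&: L = set0 by rewrite cards0.
  by apply/eqP; rewrite setI_eq0; move: sG; rewrite subsetD => /andP[].
have [|G [sG sGA cG]] := @exists_card_between A (A :\: L) k (subsetDl _ _).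
  by rewrite kA ltnW.
exists G => //; rewrite /sparse cG eqxx (subset_trans sGA) //=.
have cGL := cardsID L G.
have : (#|A :\: L| <= #|G :\: L|)%N.
  apply/subset_leq_card/subsetP => x xAL; rewrite inE (subsetP sG) // andbT.
  by case/setDP: xAL.
lia.
Qed.

Definition mono_family (I : finType) N L k q (f : {set T} -> nat) (j : nat)
    (S : {ffun I -> {set T}}) :=
  [forall i, sparse N L k q (S i) && (f (S i) == j)] &&
  [forall i, forall i', (i != i') ==> [disjoint S i & S i']].
End Sets.

(* The number of disjoint sets is #|I|; q plays the role of k - s - 1. *)
Definition Kneser (I : finType) : Prop :=
  forall (T : finType) (N L : {set T}) (k q c : nat) (f : {set T} -> nat),
    (1 < k)%N -> (forall G, sparse N L k q G -> (f G < c)%N) ->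
    (#|N :&: L| <= #|I| * q)%N -> (#|I| * k.-1 + #|I|.-1 * c < #|N|)%N ->
    exists j, exists S : {ffun I -> {set T}}, mono_family N L k q f j S.

Lemma sum_eq_leq (I : finType) (F G : I -> nat) : (forall i, F i <= G i)%N ->
  \sum_i F i = \sum_i G i -> forall i, F i = G i.
Proof.
move=> le eqs i; have [_] := leqif_sum (fun i (_ : true) => leqif_eq (le i)).
by rewrite eqs eqxx => /esym/forallP/(_ i)/eqP.
Qed.

(** * Levels and signs of partial labellings for a prime p *)

Section PrimeCase.
Variables (p : nat) (p_pr : prime p) (T : finType) (N L : {set T}).
Variables (k q c : nat) (f : {set T} -> nat).
Hypothesis k_gt1 : (1 < k)%N.
Hypothesis f_lt : forall G, sparse N L k q G -> (f G < c)%N.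
Hypothesis cardNL : (#|N :&: L| <= p * q)%N.
Hypothesis no_mono : forall j (S : {ffun 'F_p -> {set T}}),
  ~~ mono_family N L k q f j S.

Local Notation vec := {ffun T -> option 'F_p}.
Local Notation rot := (@rot_vec (Zp_trunc (pdiv p)) T).
Local Notation le := (@le_vec (Zp_trunc (pdiv p)) T).
Implicit Types (X Y : vec) (i a : 'F_p) (j : 'I_c).

Definition fiber X i := [set x | X x == Some i].
Definition colors X j :=
  [set i | [exists G, [&& sparse N L k q G, G \subset fiber X i & f G == j]]].
Definition low X := [set i | (#|fiber X i| < k.-1)%N].
(** Labels whose fiber has too few elements outside [L] for [exists_sparse] to apply, whatever its
    size. *)
Definition out X := [set i | (#|fiber X i :\: L| + q < k)%N].
Definition tip X : 'F_p :=
  odflt 0 (oapp X None [pick x | X x != None]).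

Definition lev X : nat :=
  if [exists j, colors X j != set0] then (p * k.-1 + \sum_j #|colors X j|)%N
  else (\sum_i minn #|fiber X i| k.-1)%N.

(** The sets [colors X j] are never everything, by [colors_neqT]; where only [tip] remains,
    [low_region] excludes a strictly larger labelling on the same level. *)
Definition sg X : 'F_p :=
  if [pick j | colors X j != set0] is Some j then mean (colors X j)
  else if proper_part (low X) then mean (low X)
  else if proper_part (out X) then mean (out X)
  else tip X.

Lemma fiber_rot a X i : fiber (rot a X) i = fiber X (i - a).
Proof.
apply/setP => x; rewrite !inE ffunE; case: (X x) => //= b.
by rewrite !(inj_eq Some_inj) eq_sym [RHS]eq_sym subr_eq addrC.
Qed.

Lemma colors_rot a X j : colors (rot a X) j = shift a (colors X j).
Proof. by apply/setP => i; rewrite !inE; apply: eq_existsb => G; rewrite fiber_rot. Qed.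

Lemma low_rot a X : low (rot a X) = shift a (low X).
Proof. by apply/setP => i; rewrite !inE fiber_rot. Qed.

Lemma out_rot a X : out (rot a X) = shift a (out X).
Proof. by apply/setP => i; rewrite !inE fiber_rot. Qed.

Lemma fiber_mono X Y i : le X Y -> fiber X i \subset fiber Y i.
Proof.
move=> /le_vecP h; apply/subsetP => x; rewrite !inE => /eqP Xx.
by rewrite -h Xx.
Qed.

Lemma colors_mono X Y j : le X Y -> colors X j \subset colors Y j.
Proof.
move=> leXY; apply/subsetP => i; rewrite !inE => /existsP[G /and3P[sG sGX fG]].
apply/existsP; exists G; rewrite sG fG andbT /=.
exact: subset_trans sGX (fiber_mono _ leXY).
Qed.

Lemma disjoint_fiber X i i' : i != i' -> [disjoint fiber X i & fiber X i'].
Proof.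
move=> nii; rewrite -setI_eq0; apply/eqP/setP => x; rewrite !inE; apply/negP.
by case/andP => /eqP-> /eqP[] e; rewrite e eqxx in nii.
Qed.

(** Sets of color [j] in all p fibers would be pairwise disjoint, against [no_mono]. *)
Lemma colors_neqT X j : colors X j != setT.
Proof.
apply/negP => /eqP cT.
have hG i : exists G, [&& sparse N L k q G, G \subset fiber X i & f G == j].
  by apply/existsP; have := in_setT i; rewrite -cT inE.
pose S : {ffun 'F_p -> {set T}} := [ffun i => xchoose (hG i)].
have /negP := no_mono j S; apply; apply/andP; split.
  by apply/forallP => i; rewrite ffunE; have /and3P[-> _ ->] := xchooseP (hG i).
apply/forallP => i; apply/forallP => i'; apply/implyP => nii.
have [/and3P[_ s1 _] /and3P[_ s2 _]] := (xchooseP (hG i), xchooseP (hG i')).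
rewrite !ffunE; exact: disjointW s1 s2 (disjoint_fiber X nii).
Qed.

Lemma fiber_inj X Y : le X Y -> (forall i, #|fiber X i| = #|fiber Y i|) -> X = Y.
Proof.
move=> leXY e; apply/ffunP => x; case Xx: (X x) => [i|].
  by move/le_vecP: leXY => <-; rewrite Xx.
case Yx: (Y x) => [i|] //.
have := subset_cardP (e i) (fiber_mono i leXY) x.
by rewrite !inE Xx Yx eqxx.
Qed.

Lemma sg_rot a X : supp X != set0 -> sg (rot a X) = a + sg X.
Proof.
move=> X0; rewrite /sg (@eq_pick _ _ (fun j => colors X j != set0)) => [|j]; last first.
  by rewrite /= colors_rot shift_eq0.
case: pickP => [j c0|_].
  by rewrite colors_rot mean_shift // /proper_part c0 colors_neqT.
rewrite low_rot out_rot !proper_part_shift.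
case: ifP => [|_]; first exact: mean_shift.
case: ifP => [|_]; first exact: mean_shift.
rewrite /tip (@eq_pick _ _ (fun x => X x != None)) => [|x]; last first.
  by rewrite /= ffunE; case: (X x).
case: pickP => [x|noX] /=; first by rewrite ffunE; case: (X x).
by case/set0Pn: X0 => x; rewrite inE noX.
Qed.

Lemma sum_minn_le X : (\sum_i minn #|fiber X i| k.-1 <= p * k.-1)%N.
Proof.
apply: (@leq_trans (\sum_(i : 'F_p) k.-1)).
  by apply: leq_sum => i _; apply: geq_minr.
by rewrite sum_nat_const card_Fp.
Qed.

(** Each [colors X j] misses a label, whence the factor [p.-1]; without colors, positivity comes
    from [k.-1 > 0]. *)
Lemma lev_bound X : supp X != set0 -> (0 < lev X <= p * k.-1 + p.-1 * c)%N.
Proof.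
move=> X0; rewrite /lev; case: existsP => [[j j0]|_].
  apply/andP; split.
    by rewrite addn_gt0 (bigD1 j) //= addn_gt0 card_gt0 j0 orbT.
  rewrite leq_add2l.
  rewrite -[X in (_ <= _ * X)%N]card_ord mulnC -sum_nat_const; apply: leq_sum => j' _.
  rewrite -ltnS (prednK (prime_gt0 p_pr)) -[X in (_ < X)%N](card_Fp p_pr) -cardsT.
  by rewrite proper_card // properT colors_neqT.
apply/andP; split.
  case/set0Pn: X0 => x; rewrite inE; case Xx: (X x) => [i|] // _.
  rewrite (bigD1 i) //= addn_gt0 leq_min card_gt0; apply/orP; left.
  by apply/andP; split; [apply/set0Pn; exists x; rewrite inE Xx | lia].
apply: leq_trans (leq_addr _ _).
exact: sum_minn_le.
Qed.

Lemma card_fiber_lt X i : supp X \subset N ->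
  (forall j, colors X j = set0) -> i \notin out X -> (#|fiber X i| < k)%N.
Proof.
move=> sX c0; rewrite inE -leqNgt => outi; rewrite ltnNge; apply/negP => kX.
have sub : fiber X i \subset N.
  by apply: subset_trans sX; apply/subsetP => x; rewrite !inE => /eqP->.
have [G spG sG] := exists_sparse sub kX outi.
have /setP/(_ i) := c0 (Ordinal (f_lt spG)); rewrite !inE => /existsP[].
by exists G; rewrite spG sG /=.
Qed.

Lemma low_eq0 X i : low X = set0 -> (k.-1 <= #|fiber X i|)%N.
Proof. by move=> l0; rewrite leqNgt; have := in_set0 i; rewrite -l0 inE => ->. Qed.

(* On the top level, if [out X] is everything, then counting in L shows that all
   fibers of Y have exactly k - 1 elements. *)
Lemma low_region X Y : supp X \subset N -> supp Y \subset N ->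
    (forall j, colors X j = set0) -> (forall j, colors Y j = set0) ->
    le X Y -> (forall i, minn #|fiber X i| k.-1 = minn #|fiber Y i| k.-1) ->
  X = Y \/ low X = low Y /\
    (proper_part (low X) \/ out X = out Y /\ proper_part (out X)).
Proof.
move=> sX sY cX cY leXY emin.
have le_card i : (#|fiber X i| <= #|fiber Y i|)%N.
  exact/subset_leq_card/fiber_mono.
have lowE : low X = low Y.
  by apply/setP => i; rewrite !inE; have := emin i; have := le_card i; lia.
have [pl | ] := boolP (proper_part (low X)); first by right; split=> //; left.
(* If all labels are low, the minima are the true fiber sizes and determine [X = Y]. *)
rewrite negb_and !negbK => /orP[/eqP low0 | /eqP lowT]; last first.
  left; apply: (fiber_inj leXY) => i; have := in_setT i; rewrite -lowT inE => lti.
  by have := emin i; have := le_card i; lia.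
have lowY : low Y = set0 by rewrite -lowE.
(* Off [out Y] a fiber of [Y] has at most k - 1 elements, and that of [X] has at least as many. *)
have eqY i : i \notin out Y -> fiber X i = fiber Y i.
  move=> /(card_fiber_lt sY cY) ltk; apply/eqP; rewrite eqEcard fiber_mono //=.
  by have := low_eq0 i low0; lia.
have outE : out X = out Y.
  apply/setP => i; have [iY|niY] := boolP (i \in out Y); last first.
    by rewrite -(negPf niY) !inE eqY.
  move: iY; rewrite !inE => ltY; rewrite (leq_ltn_trans _ ltY) // leq_add2r.
  by apply/subset_leq_card/setSD/fiber_mono.
have [po | ] := boolP (proper_part (out X)); first by right; split=> //; right.
rewrite negb_and !negbK.
case/orP=> [/eqP out0 | /eqP outT]; left; apply: (fiber_inj leXY) => i.
  by rewrite eqY // -outE out0 inE.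
(* Each fiber size plus [q] is at most k - 1 plus the part of the fiber in [L]; these parts are
   disjoint in [N :&: L], which has at most p q elements. *)
have sum_le : (\sum_i #|fiber Y i| <= \sum_(i : 'F_p) k.-1)%N.
  have cardY i' : (#|fiber Y i'| + q <= k.-1 + #|fiber Y i' :&: L|)%N.
    have := in_setT i'; rewrite -outT outE inE -(cardsID L (fiber Y i')); lia.
  have := @leq_sum _ (index_enum 'F_p) xpredT _ _ (fun i' _ => cardY i').
  rewrite !big_split /= [X in (_ + X <= _)%N]sum_nat_const card_Fp // => le1.
  rewrite -(leq_add2r (p * q)); apply: leq_trans le1 _; rewrite leq_add2l.
  apply: leq_trans cardNL; under eq_bigr do rewrite -sum1_card.
  rewrite -(partition_disjoint_bigcup (F := fun i => fiber Y i :&: L) _ (fun=> 1%N)).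
    rewrite sum1_card; apply/subset_leq_card/bigcupsP => i' _; apply: setSI.
    by apply: subset_trans sY; apply/subsetP => x; rewrite !inE => /eqP->.
  move=> i1 i2 ni; apply: disjointW (disjoint_fiber Y ni); exact: subsetIl.
have := low_eq0 i low0.
have sum_ge i' : (k.-1 <= #|fiber Y i'|)%N := low_eq0 i' lowY.
have : k.-1 = #|fiber Y i|.
  apply: (@sum_eq_leq _ (fun=> k.-1) (fun i => #|fiber Y i|) sum_ge).
  by apply/eqP; rewrite eqn_leq sum_le leq_sum.
have := le_card i; lia.
Qed.

Lemma lev_mono X Y : supp X \subset N -> supp Y \subset N -> le X Y ->
  (lev X <= lev Y)%N /\ (lev X = lev Y -> sg X = sg Y).
Proof.
move=> sX sY leXY.
have noc Z : ~~ [exists j, colors Z j != set0] -> forall j, colors Z j = set0.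
  by move/existsPn => c0 j; have /negPn/eqP := c0 j.
have lecol j : (#|colors X j| <= #|colors Y j|)%N by apply/subset_leq_card/colors_mono.
have lemin i : (minn #|fiber X i| k.-1 <= minn #|fiber Y i| k.-1)%N.
  have : (#|fiber X i| <= #|fiber Y i|)%N by apply/subset_leq_card/fiber_mono.
  lia.
have sglow Z : (forall j, colors Z j = set0) -> sg Z =
    if proper_part (low Z) then mean (low Z)
    else if proper_part (out Z) then mean (out Z) else tip Z.
  by move=> c0; rewrite /sg; case: pickP => // j; rewrite c0 eqxx.
rewrite /lev; have [cX|cX] := boolP [exists j, colors X j != set0].
  have -> : [exists j, colors Y j != set0].
    have /existsP[j cXj] := cX; apply/existsP; exists j.
    apply: contra cXj => /eqP cY0; rewrite -subset0 -cY0; exact: colors_mono.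
  rewrite leq_add2l; split=> [|/addnI/(sum_eq_leq lecol) ecol]; first exact: leq_sum.
  have colE j : colors X j = colors Y j.
    by apply/eqP; rewrite eqEcard colors_mono //= ecol.
  rewrite /sg (@eq_pick _ _ (fun j => colors Y j != set0)) => [|j]; last first.
    by rewrite /= colE.
  case: pickP => [j _|cY0]; first by rewrite colE.
  by have /existsP[j] := cX; rewrite colE cY0.
(* The level of [X] is at most p (k - 1) and that of [Y] exceeds it, so they cannot be equal. *)
have [cY|cY] := boolP [exists j, colors Y j != set0].
  have le1 := sum_minn_le X.
  have /existsP[j cYj] := cY.
  have : (0 < \sum_j #|colors Y j|)%N by rewrite (bigD1 j) //= addn_gt0 card_gt0 cYj.
  lia.
split=> [|/(sum_eq_leq lemin) emin]; first exact: leq_sum.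
rewrite !sglow; try exact: noc.
have [->//|[<- [->//|[<- ->]]]] := low_region sX sY (noc _ cX) (noc _ cY) leXY emin.
by case: ifP.
Qed.

Lemma card_ground : (#|N| <= p * k.-1 + p.-1 * c)%N.
Proof.
have domE X : dom (enum N) X -> supp X != set0 /\ supp X \subset N.
  case/andP => X0 /subsetP sX; split=> //; apply/subsetP => x /sX.
  by rewrite mem_enum.
rewrite cardE; apply: (Zp_tucker (sg := sg) (lev := lev)); first exact: enum_uniq.
- by move=> a X /domE[X0 _]; apply: sg_rot.
- by move=> X /domE[X0 _]; apply: lev_bound.
by move=> X Y /domE[_ sX] /domE[_ sY]; apply: lev_mono.
Qed.
End PrimeCase.

Lemma mono_familyP (T I : finType) (N L : {set T}) k q f (j : nat)
    (S : {ffun I -> {set T}}) :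
  reflect [/\ forall i, sparse N L k q (S i), forall i, f (S i) = j &
            forall i i', i != i' -> [disjoint S i & S i']]
          (mono_family N L k q f j S).
Proof.
apply: (iffP andP) => [[/forallP h1 /forallP h2] | [h1 h2 h3]]; split.
- by move=> i; case/andP: (h1 i).
- by move=> i; case/andP: (h1 i) => _ /eqP.
- by move=> i i' nii; have /forallP/(_ i')/implyP := h2 i; apply.
- by apply/forallP => i; rewrite h1 h2 eqxx.
by apply/forallP => i; apply/forallP => i'; apply/implyP; apply: h3.
Qed.

(** * Composite uniformity *)

Lemma Kneser_prime p : prime p -> Kneser 'F_p.
Proof.
move=> p_pr T N L k q c f k1 f_lt; rewrite card_Fp // => NL ltN.
case: (boolP [exists S : {ffun 'F_p -> {set T}},
               [exists j : 'I_c, mono_family N L k q f j S]]).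
  by case/existsP => S /existsP[j h]; exists (j : nat), S.
move=> none; have := card_ground p_pr k1 f_lt NL.
rewrite leqNgt ltN; case/(_ _)/negP => //.
move=> j S; apply/negP => h; case/negP: none; apply/existsP; exists S.
have ltj : (j < c)%N.
  by have [s /(_ 0) <- _] := mono_familyP _ _ _ _ _ _ _ h; apply: f_lt (s 0).
by apply/existsP; exists (Ordinal ltj).
Qed.

Lemma Kneser_unit : Kneser unit.
Proof.
move=> T N L k q c f k1 f_lt; rewrite card_unit !mul1n addn0 => NL ltN.
have [|//||G spG _] := @exists_sparse T N L k q N; first exact: subxx.
- by lia.
- by have := cardsID L N; lia.
exists (f G), [ffun=> G]; apply/mono_familyP; split=> [i|i|[] []] //; rewrite ffunE //.
Qed.

Lemma Kneser_inj (I J : finType) (h : J -> I) : injective h -> #|I| = #|J| ->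
  Kneser I -> Kneser J.
Proof.
move=> inj_h cIJ KI T N L k q c f k1 f_lt; rewrite -cIJ => NL ltN.
have [j [S /mono_familyP[s1 s2 s3]]] := KI T N L k q c f k1 f_lt NL ltN.
exists j, [ffun i => S (h i)]; apply/mono_familyP; split=> i; rewrite !ffunE //.
by move=> i' nii; rewrite ffunE s3 // (inj_eq inj_h).
Qed.

Lemma Kneser_prod (I J : finType) : (0 < #|I|)%N -> (0 < #|J|)%N ->
  Kneser I -> Kneser J -> Kneser (I * J)%type.
Proof.
move=> I0 J0 KI KJ T N L k q c f k1 f_lt; rewrite card_prod => NL ltN.
(* [k'] is the least size of a set to which the statement for [J] applies. *)
pose k' := (#|J| * k.-1 + #|J|.-1 * c).+1; pose q' := (#|J| * q)%N.
pose has_mono M j := [exists S : {ffun J -> {set T}}, mono_family M L k q f j S].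
have monoM M : sparse N L k' q' M -> exists j : 'I_c, has_mono M j.
  case/and3P => sMN /eqP cM ML.
  have sub G : sparse M L k q G -> sparse N L k q G.
    by case/and3P => sG cG GL; rewrite /sparse (subset_trans sG sMN) cG.
  have [|||j [S mS]] := KJ T M L k q c f k1 => //; first by move=> G /sub; apply: f_lt.
    by rewrite cM.
  have ltj : (j < c)%N.
    have /card_gt0P[i _] := J0.
    by have [s /(_ i) <- _] := mono_familyP _ _ _ _ _ _ _ mS; apply/f_lt/sub/(s i).
  by exists (Ordinal ltj); apply/existsP; exists S.
(* The default 0 is never reached on the sparse sets of size [k'], by [monoM]. *)
pose f' M := if [pick j : 'I_c | has_mono M j] is Some j then (j : nat) else 0%N.
have f'P M : sparse N L k' q' M -> has_mono M (f' M) /\ (f' M < c)%N.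
  move=> /monoM[j hj]; rewrite /f'; case: pickP => [j' //|/(_ j)]; by rewrite hj.
have [||||j [S /mono_familyP[s1 s2 s3]]] := KI T N L k' q' c f'.
- by rewrite /k' ltnS addn_gt0 muln_gt0 J0 -subn1 subn_gt0 k1.
- by move=> M /f'P[].
- by rewrite mulnA.
(* The color terms combine exactly: |I| (|J| - 1) + (|I| - 1) = |I| |J| - 1. *)
- apply: leq_trans ltN; rewrite /k' ltnS /=.
  case: #|I| I0 => // a _; case: #|J| J0 => // b _ /=; lia.
have hS i : exists S' : {ffun J -> {set T}}, mono_family (S i) L k q f j S'.
  by apply/existsP; have [] := f'P _ (s1 i); rewrite s2.
pose S' i := xchoose (hS i).
have s' i := mono_familyP _ _ _ _ _ _ _ (xchooseP (hS i)).
exists j, [ffun u => S' u.1 u.2]; apply/mono_familyP.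
split=> [u|u|[u1 u2] [v1 v2]]; rewrite !ffunE.
- have [/(_ u.2)/and3P[sG cG GL] _ _] := s' u.1.
  by have /and3P[sN _ _] := s1 u.1; rewrite /sparse (subset_trans sG sN) cG.
- by have [_ -> _] := s' u.1.
have [e|ne _] := eqVneq u1 v1.
  rewrite -e xpair_eqE eqxx /= => ne; have [_ _] := s' u1; exact.
apply: disjointW (s3 _ _ ne).
  by have [/(_ u2)/and3P[]] := s' u1.
by have [/(_ v2)/and3P[]] := s' v1.
Qed.

Lemma Kneser_card r (I : finType) : (0 < r)%N -> #|I| = r -> Kneser I.
Proof.
elim/ltn_ind: r I => r IH I r0 cI.
have bij (J : finType) : #|J| = r -> Kneser J -> Kneser I.
  move=> cJ; have e : #|I| = #|J| by rewrite cI.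
  apply: (Kneser_inj (h := fun i => enum_val (cast_ord e (enum_rank i)))) => //.
  by move=> i i' /enum_val_inj/cast_ord_inj/enum_rank_inj.
have [r1 | r_gt1] := leqP r 1.
  by apply: (bij unit); [rewrite card_unit; lia | apply: Kneser_unit].
have p_pr := pdiv_prime r_gt1; have [s def_r] := dvdnP (pdiv_dvd r).
have s0 : (0 < s)%N by rewrite lt0n; apply: contraTneq r0 => s0; rewrite def_r s0.
have ltsr : (s < r)%N by rewrite def_r ltn_Pmulr ?prime_gt1.
apply: (bij ('F_(pdiv r) * 'I_s)%type).
  by rewrite card_prod card_Fp // card_ord mulnC -def_r.
apply: Kneser_prod; [|by rewrite card_ord|exact: Kneser_prime|].
  by rewrite card_Fp ?prime_gt0.
by apply: (IH s); rewrite ?card_ord.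
Qed.

(** * From disjoint sets to sets with small intersections *)

Section Extension.
Variables (n k r s a : nat).
Hypotheses (hk : (2 <= k)%N) (hr : (2 <= r)%N) (hn : (r * k <= n)%N) (hs : (s < k)%N).
Hypothesis ha : (a <= r * (k - s - 1))%N.
Local Notation L := (last_elements n a).

Lemma card_last_elements : (#|L| <= a)%N.
Proof.
rewrite cardE -(size_map val) -[leqRHS](size_iota (n - a)); apply: uniq_leq_size.
  by rewrite map_inj_uniq ?enum_uniq //; apply: val_inj.
move=> _ /mapP[i iL ->]; rewrite mem_iota; move: iL; rewrite mem_enum inE => ->.
by have := ltn_ord i; rewrite /=; lia.
Qed.

(** If [F :\: E] lies in [L], then [E] contains [F :\: L]. *)
Lemma mem_kfamily (F : {set 'I_n}) :
  #|F| = k -> (s < #|F :\: L|)%N -> F \in kfamily n k a s.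
Proof.
move=> cF FL; rewrite inE cF eqxx /=; apply/existsPn => E; rewrite negb_and -ltnNge.
case: leqP => //= leE; apply: contraTN FL; rewrite -leqNgt => sFE.
apply: leq_trans leE; apply/subset_leq_card/subsetP => x /setDP[xF xL].
by apply: contraNT xL => xE; rewrite (subsetP sFE) // inE xE.
Qed.

(** Padding outside [L] leaves [F :&: L] no larger than [G :&: L]. If too few elements are available
    there, [F] contains the whole complement of [L], of size at least n - a >= r (s + 1) > s. *)
Lemma exists_kfamily_superset G : sparse setT L (k - s %/ 2)%N (k - s - 1)%N G ->
  exists2 F, F \in kfamily n k a s & G \subset F.
Proof.
case/and3P => _ /eqP cG GL; have cardL := card_last_elements.
have nE := cardsC L; rewrite card_ord in nE.
have [leU | ltU] := leqP k #|G :|: ~: L|.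
  have [|F [sGF sFU cF]] := @exists_card_between _ (G :|: ~: L) G k (subsetUl _ _).
    by rewrite cG leq_subr.
  exists F => //; apply: mem_kfamily => //.
  rewrite -[ltnRHS](addnK #|F :&: L|) addnC cardsID cF.
  suff : (#|F :&: L| <= #|G :&: L|)%N by lia.
  apply/subset_leq_card/subsetP => x /setIP[/(subsetP sFU)].
  rewrite !inE => /orP[->->//|].
  by move=> /negPf->.
have [|F [sUF _ cF]] := @exists_card_between _ setT (G :|: ~: L) k (subsetT _).
  by rewrite ltnW //= cardsT card_ord; apply: leq_trans hn; rewrite leq_pmull //; lia.
exists F; last by apply: subset_trans sUF; apply: subsetUl.
apply: mem_kfamily => //; have : (#|~: L| <= #|F :\: L|)%N.
  rewrite subset_leq_card // setDE subsetI subxx andbT.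
  by apply: subset_trans sUF; apply: subsetUr.
have : (r * (s + 1) <= n - a)%N.
  have : (r * (k - s - 1) + r * (s + 1) = r * k)%N.
    by rewrite -mulnDr; congr (_ * _)%N; lia.
  lia.
have : (s + 1 <= r * (s + 1))%N by rewrite leq_pmull //; lia.
lia.
Qed.

Lemma KG_color_bound c : colorable (KG r n k a s) c ->
  (n <= r * (k - s %/ 2).-1 + r.-1 * c)%N.
Proof.
case/existsP => phi /forall_inP proper_phi; rewrite leqNgt; apply/negP => ltn_n.
pose pk (G : {set _}) := [pick v : vertex n k a s | G \subset val v].
pose f G := if pk G is Some v then (phi v : nat) else 0%N.
have pkP G : sparse setT L (k - s %/ 2)%N (k - s - 1)%N G ->
    exists v : vertex n k a s, pk G = Some v /\ G \subset val v.
  move=> /exists_kfamily_superset[F hF sGF]; rewrite /pk; case: pickP => [v sGv|].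
    by exists v.
  by move=> /(_ (Sub F hF)); rewrite SubK sGF.
have r0 : (0 < r)%N by lia.
have [||||j [S /mono_familyP[s1 s2 s3]]] :=
  @Kneser_card r 'I_r r0 (card_ord r) 'I_n setT L (k - s %/ 2)%N (k - s - 1)%N c f.
- lia.
- by move=> G /pkP[v [e _]]; rewrite /f e.
- by rewrite setTI card_ord (leq_trans card_last_elements).
- by rewrite card_ord cardsT card_ord.
have [v vP] := fin_all_exists (fun i => pkP _ (s1 i)).
have card_v i : #|val (v i)| = k by have := valP (v i); rewrite inE => /andP[/eqP].
have inter i i' : i != i' -> (#|val (v i) :&: val (v i')| <= s)%N.
  move=> /s3 dis; have [[_ sub] [_ sub']] := (vP i, vP i').
  have card_ext u : #|val (v u) :\: S u| = (s %/ 2)%N.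
    have [_ subu] := vP u; have /and3P[_ /eqP cS _] := s1 u.
    by rewrite cardsD (setIidPr subu) card_v cS; lia.
  (* As [S i] and [S i'] are disjoint, each common element lies in the padding of one of them. *)
  apply: (@leq_trans #|(val (v i) :\: S i) :|: (val (v i') :\: S i')|).
    apply/subset_leq_card/subsetP => x /setIP[xi xi']; rewrite !inE xi xi' !andbT.
    rewrite -negb_and; apply/negP => /andP[xS].
    by rewrite (disjointFr dis xS).
  apply: leq_trans (leq_card_setU _ _) _; rewrite !card_ext; lia.
(* Equal vertices at distinct indices would meet in k > s elements; so the [v i] form an edge with
   exactly [r] vertices. *)
have v_inj : injective v.
  move=> i i' e; apply/eqP/negPn/negP => /inter; rewrite e setIid card_v; lia.
have /proper_phi/negP[] : [set v i | i in 'I_r] \in KG r n k a s.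
  rewrite inE card_imset // card_ord eqxx /=; apply/forall_inP => _ /imsetP[i _ ->].
  apply/forall_inP => _ /imsetP[i' _ ->]; apply/implyP => ne; apply: inter.
  by apply: contraNneq ne => ->.
apply/existsP; exists (phi (v (Ordinal r0))); apply/forall_inP => _ /imsetP[i _ ->].
by apply/eqP/val_inj; have := s2 i; rewrite -(s2 (Ordinal r0)) /f !(proj1 (vP _)).
Qed.
End Extension.

Theorem theorem7 (n k r s a : nat)
    (hk : (2 <= k)%N) (hr : (2 <= r)%N) (han : (a < n)%N)
    (hn : (r * k <= n)%N) (hs : (s < k)%N) (ha : (a <= r * (k - s - 1))%N) :
  Num.ceil ((n%:R - r%:R * (k%:R - (s %/ 2)%:R - 1)) / (r%:R - 1) : rat)
    <= (chromatic_number (KG r n k a s))%:Z.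
Proof.
(* Edges have r >= 2 vertices, so the chromatic number is attained by a proper coloring. *)
have [|col _] := @chromatic_numberP _ (KG r n k a s); first by move=> e /KG_uniform ->.
have := KG_color_bound hk hr hn hs ha col.
set c := chromatic_number _ => bound.
have r1 : 0 < r%:R - 1 :> rat by rewrite subr_gt0 ltr1n.
rewrite ceil_le_int ler_pdivrMr // lerBlDl.
(* Since [s %/ 2 < k], the truncated subtractions are exact. *)
have -> : k%:R - (s %/ 2)%:R - 1 = (k - s %/ 2).-1%:R :> rat.
  by rewrite -subn1 !natrB //; lia.
have -> : r%:R - 1 = r.-1%:R :> rat by rewrite -subn1 natrB //; lia.
by rewrite -pmulrn -!natrM -natrD ler_nat [(c * _)%N]mulnC.
Qed.
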